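(* Let $A$ and $B$ be associative rings with unity, let ${}_AM_B$ be a non-trivial (i.e. nonzero) $A$-$B$-bimodule, and let $R=\begin{pmatrix} A & M\\ 0 & B\end{pmatrix}$ be the corresponding formal triangular matrix ring. Then $\operatorname{Nin}(R)=4$ if and only if one of the following holds: (1) $(M,+)\cong C_2$ and $\operatorname{Nin}(A)\operatorname{Nin}(B)=2$. (2) $(M,+)\cong C_4$ and $\operatorname{Nin}(A)=\operatorname{Nin}(B)=1$. (3) $(M,+)\cong C_2\oplus C_2$ and one of the following holds: (a) $\operatorname{Nin}(A)=\operatorname{Nin}(B)=1$. (b) $\operatorname{Nin}(A)=1$; $B=\begin{pmatrix} S & W\\ 0 & T\end{pmatrix}$ for some rings $S,T$ and some $S$-$T$-bimodule $W$ with $\operatorname{Nin}(S)=\operatorname{Nin}(T)=1$ and $|W|=2$; and $eM(1_B-f)+(1_A-e)Mf\neq 0$ for all $e\in A$ with $e^2=e$ and all $f\in\eta(b)$, where $b$ ranges over all elements of $B$ with $|\eta(b)|=2$. (c) $\operatorname{Nin}(B)=1$; $A=\begin{pmatrix} S & W\\ 0 & T\end{pmatrix}$ for some rings $S,T$ and some $S$-$T$-bimodule $W$ with $\operatorname{Nin}(S)=\operatorname{Nin}(T)=1$ and $|W|=2$; and $eM(1_B-f)+(1_A-e)Mf\neq 0$ for all $f\in B$ with $f^2=f$ and all $e\in\eta(a)$, where $a$ ranges over all elements of $A$ with $|\eta(a)|=2$.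
   Context: All rings are associative with unity, and bimodules are unital. For a ring $R$, $\operatorname{nil}(R)$ denotes the set of nilpotent elements of $R$. For $a\in R$, $\eta(a)=\{e\in R : e^2=e \text{ and } a-e\in\operatorname{nil}(R)\}$ (computed in the ring to which $a$ belongs). The nil clean index of $R$ is $\operatorname{Nin}(R)=\sup\{|\eta(a)| : a\in R\}$, where $|X|$ denotes the cardinality of a set $X$. $C_n$ denotes the cyclic group of order $n$. For rings $A,B$ and an $A$-$B$-bimodule $M$, the formal triangular matrix ring $\begin{pmatrix} A & M\\ 0 & B\end{pmatrix}$ consists of the matrices $\begin{pmatrix} a & x\\ 0 & b\end{pmatrix}$ with $a\in A$, $x\in M$, $b\in B$, with entrywise addition and the usual matrix multiplication. An equality such as $B=\begin{pmatrix} S & W\\ 0 & T\end{pmatrix}$ between a given ring and a formal triangular matrix ring is understood up to ring isomorphism. For idempotents $e\in A$ and $f\in B$, $eM(1_B-f)+(1_A-e)Mf$ denotes the sum of the additive subgroups $\{ex(1_B-f):x\in M\}$ and $\{(1_A-e)xf:x\in M\}$ of $M$. *)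

(* Defs.v *)
From HB Require Import structures.
From mathcomp Require Import all_boot all_order all_algebra finmap.
From mathcomp Require Import boolp classical_sets functions cardinality.
From mathcomp Require Import reals constructive_ereal ereal.

Set Implicit Arguments.
Unset Strict Implicit.
Unset Printing Implicit Defensive.

Import Order.TTheory GRing.Theory Num.Theory.

Local Open Scope classical_set_scope.
Local Open Scope ring_scope.

Section Cardinal.
Variable T : choiceType.

(* Cardinality with all infinite cardinals identified with +oo. Only lub's of
   sets of such values are taken, and these exist already in \bar rat
   (lemmas Nin_ub and Nin_le below), so no real numbers are needed. *)
Definition ecard (X : set T) : \bar rat :=
  if `[< finite_set X >] then (#|` fset_set X|%fset)%:R%:E else +oo%E.

End Cardinal.

(* Rings are [pzRingType]s: associative, unital, with 1 = 0 not excluded. *)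

Section NilClean.
Variable R : pzRingType.

Definition nilpotents : set R := [set x | exists n : nat, x ^+ n = 0].

Definition idempotents : set R := [set e | e * e = e].

Definition eta_set (a : R) : set R :=
  [set e | idempotents e /\ nilpotents (a - e)].

Definition Nin : \bar rat := ereal_sup [set ecard (eta_set a) | a in [set: R]].

End NilClean.

Section NinTheory.
Variable R : pzRingType.

Let cards := [set ecard (eta_set a) | a in [set: R]].

Let has_lub_cards : supremums cards !=set0.
Proof.
have [[n ub]|unb] :=
    pselect (exists n : nat, forall a : R, (ecard (eta_set a) <= n%:R%:E)%E).
  have ex : exists n : nat,
      `[< forall a : R, (ecard (eta_set a) <= n%:R%:E)%E >].
    by exists n; apply/asboolP.
  case: (ex_minnP ex) => m /asboolP um mmin.
  exists m%:R%:E; split; first by move=> _ [a _ <-]; exact: um.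
  move=> y uy; have [[a ha]|na] :=
      pselect (exists a : R, ecard (eta_set a) = m%:R%:E).
    by rewrite -ha; apply: uy; exists a.
  exfalso; case: m um mmin na => [|m] um mmin na.
    apply: na; exists 0; apply/eqP; rewrite eq_le um /= /ecard.
    by case: ifP => _; rewrite ?leey // lee_fin ler0n.
  suff /mmin : `[< forall a : R, (ecard (eta_set a) <= m%:R%:E)%E >].
    by rewrite ltnn.
  apply/asboolP => a; have := um a.
  have /eqP : ecard (eta_set a) <> m.+1%:R%:E by move=> h; apply: na; exists a.
  rewrite /ecard; case: ifP => _ //.
  by rewrite eqe eqr_nat !lee_fin !ler_nat leq_eqVlt ltnS => /negbTE ->.
exists +oo%E; split; first by move=> y _; exact: leey.
move=> y uy; rewrite leye_eq; case: y uy => [r| |] // uy; exfalso.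
  apply: unb; exists (Num.truncn r).+1 => a.
  apply: le_trans (uy _ _) _; first by exists a.
  by rewrite lee_fin ltW // truncnS_gt.
have /(_ (ecard (eta_set (0 : R)))) := uy.
have h : cards (ecard (eta_set (0 : R))) by exists 0.
by move=> /(_ h); rewrite /ecard; case: ifP.
Qed.

Let Nin_lub : supremums cards (Nin R).
Proof.
rewrite /Nin /ereal_sup /supremum ifF; last first.
  by apply/negbTE/set0P; exists (ecard (eta_set (0 : R))); exists 0.
by case: xgetP => [y -> //|no]; case: has_lub_cards => y /no.
Qed.

Lemma Nin_ub (a : R) : (ecard (eta_set a) <= Nin R)%E.
Proof. by apply: (proj1 Nin_lub); exists a. Qed.

Lemma Nin_le (y : \bar rat) :
  (forall a : R, (ecard (eta_set a) <= y)%E) -> (Nin R <= y)%E.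
Proof. by move=> uy; apply: (proj2 Nin_lub) => _ [a _ <-]. Qed.

End NinTheory.

Reserved Notation "x :*> b" (at level 40, left associativity).

HB.mixin Record Lmodule_isBimodule (A B : pzRingType) M
    of GRing.Lmodule A M := {
  ract : M -> B -> M;
  ractDl : forall (x y : M) (b : B), ract (x + y) b = ract x b + ract y b;
  ractDr : forall (x : M) (b c : B), ract x (b + c) = ract x b + ract x c;
  ractA : forall (x : M) (b c : B), ract x (b * c) = ract (ract x b) c;
  ract1 : forall x : M, ract x 1 = x;
  scale_ractA : forall (a : A) (x : M) (b : B),
    a *: ract x b = ract (a *: x) b
}.

#[short(type="bimodType")]
HB.structure Definition Bimodule (A B : pzRingType) :=
  {M of GRing.Lmodule A M & Lmodule_isBimodule A B M}.

Notation "x :*> b" := (ract x b) : ring_scope.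

Record trimx (A B : pzRingType) (M : bimodType A B) :=
  TriMx { ulmx : A; urmx : M; drmx : B }.

Section TriangularRing.
Variables (A B : pzRingType) (M : bimodType A B).
Implicit Types u v w : trimx M.

Definition prod_of_trimx u : A * M * B := (ulmx u, urmx u, drmx u).
Definition trimx_of_prod (p : A * M * B) : trimx M := TriMx p.1.1 p.1.2 p.2.

Lemma prod_of_trimxK : cancel prod_of_trimx trimx_of_prod.
Proof. by case. Qed.

HB.instance Definition _ := Choice.copy (trimx M) (can_type prod_of_trimxK).

Definition trimx_zero : trimx M := TriMx 0 0 0.
Definition trimx_opp u : trimx M := TriMx (- ulmx u) (- urmx u) (- drmx u).
Definition trimx_add u v : trimx M :=
  TriMx (ulmx u + ulmx v) (urmx u + urmx v) (drmx u + drmx v).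
Definition trimx_one : trimx M := TriMx 1 0 1.
Definition trimx_mul u v : trimx M :=
  TriMx (ulmx u * ulmx v) (ulmx u *: urmx v + urmx u :*> drmx v)
        (drmx u * drmx v).

Fact trimx_addA : associative trimx_add.
Proof. by move=> u v w; rewrite /trimx_add /= !addrA. Qed.

Fact trimx_addC : commutative trimx_add.
Proof.
move=> u v; rewrite /trimx_add.
by rewrite (addrC (ulmx u)) (addrC (urmx u)) (addrC (drmx u)).
Qed.

Fact trimx_add0 : left_id trimx_zero trimx_add.
Proof. by case=> a x b; rewrite /trimx_add /= !add0r. Qed.

Fact trimx_addN : left_inverse trimx_zero trimx_opp trimx_add.
Proof. by case=> a x b; rewrite /trimx_add /= !addNr. Qed.

HB.instance Definition _ := GRing.isZmodule.Build (trimx M)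
  trimx_addA trimx_addC trimx_add0 trimx_addN.

Let ract0r (b : B) : (0 : M) :*> b = 0.
Proof. by apply: (addrI ((0 : M) :*> b)); rewrite -ractDl !addr0. Qed.

Fact trimx_mulA : associative trimx_mul.
Proof.
move=> u v w; rewrite /trimx_mul /= !mulrA; congr TriMx.
by rewrite scalerDr ractDl scalerA ractA scale_ractA addrA.
Qed.

Fact trimx_mul1l : left_id trimx_one trimx_mul.
Proof.
by case=> a x b; rewrite /trimx_mul /= !mul1r scale1r ract0r addr0.
Qed.

Fact trimx_mul1r : right_id trimx_one trimx_mul.
Proof.
by case=> a x b; rewrite /trimx_mul /= !mulr1 scaler0 ract1 add0r.
Qed.

Fact trimx_mulDl : left_distributive trimx_mul trimx_add.
Proof.
move=> u v w; rewrite /trimx_mul /trimx_add /= !mulrDl; congr TriMx.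
by rewrite scalerDl ractDl addrACA.
Qed.

Fact trimx_mulDr : right_distributive trimx_mul trimx_add.
Proof.
move=> u v w; rewrite /trimx_mul /trimx_add /= !mulrDr; congr TriMx.
by rewrite scalerDr ractDr addrACA.
Qed.

HB.instance Definition _ := GRing.Zmodule_isPzRing.Build (trimx M)
  trimx_mulA trimx_mul1l trimx_mul1r trimx_mulDl trimx_mulDr.

Definition offdiag (e : A) (f : B) : set M :=
  [set e *: x :*> (1 - f) + (1 - e) *: y :*> f | x in [set: M] & y in [set: M]].

End TriangularRing.

Arguments offdiag {A B} M e f.

Definition group_iso (U V : zmodType) : Prop :=
  exists f : {additive U -> V}, bijective f.

Definition ring_iso (R S : pzRingType) : Prop :=
  exists f : {rmorphism R -> S}, bijective f.

(* Main.v *)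
Require Import Defs.
From HB Require Import structures.
From mathcomp Require Import all_boot all_order all_algebra.
From mathcomp Require Import boolp classical_sets functions cardinality.
From mathcomp Require Import reals constructive_ereal ereal.
From mathcomp Require Import finmap zify.

Set Implicit Arguments.
Unset Strict Implicit.
Unset Printing Implicit Defensive.

Import Order.TTheory GRing.Theory Num.Theory.

Local Open Scope classical_set_scope.
Local Open Scope ring_scope.

(** Let R be the triangular matrix ring of A, B and M. A matrix with diagonal
    (e, f) and off-diagonal entry x is idempotent exactly when e and f are and
    x = e x + x f, that is, when x lies in the subgroup
    I(e, f) = e M (1 - f) + (1 - e) M f; it is nilpotent exactly when its
    diagonal entries are. Hence for a matrix with diagonal (a, b) the set eta
    has cardinality the sum of |I(e, f)| over e in eta(a) and f in eta(b)
    ([trimx_at_least]). Since I(1, 0) = M, the equality Nin R = 4 forces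
    |M| <= 4. Moreover M is the direct sum of I(e, f) and I(1 - e, f), and
    also of I(e, f) and I(e, 1 - f), so that the product of their orders is |M|
    ([weightCl], [weightCr]).

    If |M| is prime, M is indecomposable and idempotents act on it as 0 or 1.
    Two idempotents over the same element a act in the same way, since a and
    a - 1 cannot both act nilpotently. So |I(e, f)| depends on a and b only; it
    is |M| or 1, and is |M| after replacing a by 1 - a if necessary. This gives
    Nin R = |M| Nin A Nin B ([trimx_prime_Nin_ge]), which settles the orders 2
    and 3.

    If |M| = 4, the weights |I(e, f)| and |I(1 - e, f)| have product 4, hence
    sum at least 4. Adding the bounds |eta| <= 4 over (a, b) and over
    (1 - a, b) shows that |eta(a)| |eta(b)| <= 2, and that when one factor is 2
    all the weights involved are 2, that is, no I(e, f) vanishes; conversely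
    this bounds |eta| by 4 ([weight4P]). In particular, if one of the indices
    of A and B is 2, then M is a direct sum of two groups of order 2, so that
    M cyclic of order 4 forces both indices to be 1.

    Finally, a ring has index 2 exactly when it is triangular over two rings of
    index 1 with an off-diagonal part of order 2 ([Nin2P]): index 1 holds for
    abelian rings, a nonabelian ring has a nonzero e R (1 - e), and distinct
    elements y of e R (1 - e) and (1 - e) R e give distinct idempotents e + y
    over e.
    The bimodule of order 2 obtained in this way is then subject to the formula
    for prime order. *)

(** * Counting with duplicate-free lists *)

(** Lower bounds on cardinalities are witnessed by lists, which treats finite
    and infinite sets alike. *)
Definition at_least (T : choiceType) (n : nat) (X : set T) :=
  exists s : seq T, [/\ uniq s, (n <= size s)%N & forall x, x \in s -> X x].

Lemma at_least_leq (T : choiceType) (m n : nat) (X : set T) :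
  (m <= n)%N -> at_least n X -> at_least m X.
Proof.
by move=> mn [s [us ns sX]]; exists s; split=> //; exact: leq_trans ns.
Qed.

Lemma at_least_image (T U : choiceType) (n : nat) (X : set T) (Y : set U)
    (g : T -> U) :
  injective g -> (forall x, X x -> Y (g x)) -> at_least n X -> at_least n Y.
Proof.
move=> gI gXY [s [us ns sX]]; exists (map g s).
rewrite map_inj_uniq // size_map; split=> //.
by move=> _ /mapP[x /sX Xx ->]; exact: gXY.
Qed.

Lemma ecard_list (T : choiceType) (X : set T) (s : seq T) :
  uniq s -> (forall x, X x <-> x \in s) -> ecard X = (size s)%:R%:E.
Proof.
move=> us sX; have -> : X = [set` [fset x in s]%fset].
  by apply/seteqP; split=> x /=; rewrite in_fset_ sX.
rewrite /ecard; case: asboolP => [_|[]]; last exact: finite_fset.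
by rewrite set_fsetK card_fseq undup_id.
Qed.

Lemma ecardP (T : choiceType) (X : set T) (n : nat) :
  (n%:R%:E <= ecard X)%E <-> at_least n X.
Proof.
have [/finite_seqP[s sX]|infX] := pselect (finite_set X).
  rewrite (@ecard_list _ X (undup s)) ?undup_uniq //; last first.
    by move=> x; rewrite sX mem_undup.
  rewrite lee_fin ler_nat; split=> [ns|[t [ut nt tX]]].
    exists (undup s); split=> // [|x]; first exact: undup_uniq.
    by rewrite mem_undup sX.
  apply: leq_trans nt _; apply: uniq_leq_size => // x /tX.
  by rewrite sX mem_undup.
rewrite /ecard; case: asboolP => // _; rewrite leey; split=> // _.
have [F FX nF] := infinite_set_fset n infX.
by exists (enum_fset F); split=> // x xF; apply: FX.
Qed.

Lemma ecard_eqP (T : choiceType) (X : set T) (n : nat) :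
  ecard X = n%:R%:E <-> at_least n X /\ ~ at_least n.+1 X.
Proof.
split=> [eX|[/ecardP h1 /ecardP h2]].
  by split=> [|/ecardP]; [apply/ecardP|]; rewrite eX // lee_fin ler_nat ltnn.
move: h1 h2; rewrite /ecard; case: asboolP => _; last by rewrite !leey.
by rewrite !lee_fin !ler_nat => h1 h2; congr (_%:R%:E); lia.
Qed.

Lemma bounded_list (T : choiceType) (X : set T) (n : nat) :
  ~ at_least n.+1 X ->
  exists s : seq T, [/\ uniq s, (size s <= n)%N & forall x, X x <-> x \in s].
Proof.
move=> bX; have [/finite_seqP[s sX]|infX] := pselect (finite_set X); last first.
  by case: bX; apply/ecardP; rewrite /ecard; case: asboolP; rewrite ?leey.
exists (undup s); split; first exact: undup_uniq.
  rewrite leqNgt; apply/negP => ns; apply: bX; exists (undup s).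
  by split=> // [|x]; [exact: undup_uniq | rewrite mem_undup sX].
by move=> x; rewrite mem_undup sX.
Qed.

(** The list-based form of the inequality n <= Nin R. *)
Definition Nin_ge (R : pzRingType) (n : nat) :=
  exists a : R, at_least n (eta_set a).

Lemma Nin_ge_leq (R : pzRingType) (m n : nat) :
  (m <= n)%N -> Nin_ge R n -> Nin_ge R m.
Proof. by move=> mn [a ha]; exists a; exact: at_least_leq ha. Qed.

Lemma idempotents0 (R : pzRingType) : idempotents (0 : R).
Proof. by rewrite /idempotents /= mulr0. Qed.

Lemma idempotents1 (R : pzRingType) : idempotents (1 : R).
Proof. by rewrite /idempotents /= mulr1. Qed.

Lemma eta_set_id (R : pzRingType) (e : R) : idempotents e -> eta_set e e.
Proof. by move=> he; split=> //; exists 1%N; rewrite subrr expr1. Qed.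

Lemma Nin_ge1 (R : pzRingType) : Nin_ge R 1.
Proof.
exists 0, [:: 0]; split=> // x; rewrite inE => /eqP ->.
exact/eta_set_id/idempotents0.
Qed.

Lemma Nin_geP (R : pzRingType) (n : nat) :
  (n%:R%:E <= Nin R)%E <-> Nin_ge R n.
Proof.
split=> [|[a /ecardP ha]]; last exact: le_trans ha (Nin_ub a).
case: n => [|n] hn; first exact: Nin_ge_leq (Nin_ge1 R).
apply: contrapT => hR; move: hn; apply/negP; rewrite -ltNge.
apply: (@le_lt_trans _ _ n%:R%:E); last by rewrite lte_fin ltr_nat.
apply: Nin_le => a; have /bounded_list[s [us sn sP]] :
  ~ at_least n.+1 (eta_set a) by move=> ha; apply: hR; exists a.
by rewrite (ecard_list us sP) lee_fin ler_nat.
Qed.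

Lemma Nin_eqP (R : pzRingType) (n : nat) :
  Nin R = n%:R%:E <-> Nin_ge R n /\ ~ Nin_ge R n.+1.
Proof.
split=> [eR|[/Nin_geP h1 h2]].
  by split=> [|/Nin_geP]; [apply/Nin_geP|]; rewrite eR // lee_fin ler_nat ltnn.
apply/eqP; rewrite eq_le h1 andbT; apply: Nin_le => a.
have /bounded_list[s [us sn sP]] :
  ~ at_least n.+1 (eta_set a) by move=> ha; apply: h2; exists a.
by rewrite (ecard_list us sP) lee_fin ler_nat.
Qed.

Lemma Nin1P (R : pzRingType) : Nin R = 1%:E <-> ~ Nin_ge R 2.
Proof.
rewrite -[1%:E]/(1%:R%:E) Nin_eqP; split=> [[]//|h]; split=> //.
exact: Nin_ge1.
Qed.

Lemma Nin2_geP (R : pzRingType) :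
  Nin R = 2%:E <-> Nin_ge R 2 /\ ~ Nin_ge R 3.
Proof. by rewrite -[2%:E]/(2%:R%:E) Nin_eqP. Qed.

Lemma Nin4_geP (R : pzRingType) :
  Nin R = 4%:E <-> Nin_ge R 4 /\ ~ Nin_ge R 5.
Proof. by rewrite -[4%:E]/(4%:R%:E) Nin_eqP. Qed.

Lemma Nin_ge_bound (R : pzRingType) (k n : nat) :
  ~ Nin_ge R n.+1 -> Nin_ge R k -> (k <= n)%N.
Proof.
move=> Rn Rk; rewrite leqNgt; apply/negP => h.
by apply: Rn; exact: Nin_ge_leq Rk.
Qed.

(** Both indices are at least 1, so only the factorizations 1 * 2 and 2 * 1
    are possible; an infinite index makes the product infinite. *)
Lemma Nin_mul2P (A B : pzRingType) :
  (Nin A * Nin B = 2%:E)%E <->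
  (Nin A = 1%:E /\ Nin B = 2%:E) \/ (Nin A = 2%:E /\ Nin B = 1%:E).
Proof.
split=> [h|[[-> ->]|[-> ->]]]; last 2 first.
- by rewrite -EFinM mul1r.
- by rewrite -EFinM mulr1.
have Nle (R : pzRingType) n : ~ Nin_ge R n.+1 ->
    exists2 k, Nin R = k%:R%:E & (0 < k)%N.
  elim: n => [|n IH] hn; first by case: hn; exact: Nin_ge1.
  have [hR|/IH//] := pselect (Nin_ge R n.+1).
  by exists n.+1 => //; apply/Nin_eqP.
have NV (R : pzRingType) : Nin R = +oo%E \/
    exists2 k, Nin R = k%:R%:E & (0 < k)%N.
  have [[n /Nle]|hR] := pselect (exists n, ~ Nin_ge R n.+1); first by right.
  left; have hall n : (n.+1%:R%:E <= Nin R)%E.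
    by apply/Nin_geP; apply: contrapT => hn; apply: hR; exists n.
  case: (Nin R) hall => [r| |] // hall; last by have := hall 0%N.
  have := hall (Num.truncn r); rewrite lee_fin leNgt.
  by rewrite truncnS_gt.
case: (NV A) h => [->|[k -> k0]]; case: (NV B) => [->|[l -> l0]].
- by [].
- by rewrite mulyr gtr0_sg ?ltr0n // mul1e.
- by rewrite mulry gtr0_sg ?ltr0n // mul1e.
rewrite -EFinM -natrM -[2%:E]/(2%:R%:E) -[1%:E]/(1%:R%:E).
move=> [/eqP]; rewrite eqr_nat => /eqP kl.
have [|] : (k = 1 /\ l = 2)%N \/ (k = 2 /\ l = 1)%N by nia.
  by move=> [-> ->]; left.
by move=> [-> ->]; right.
Qed.

(** * Rings of nil clean index one *)

Lemma at_least2P (T : choiceType) (X : set T) :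
  at_least 2 X <-> exists x y : T, [/\ x <> y, X x & X y].
Proof.
split=> [[[|x [|y s]] [//= us _ sX]]|[x [y [xy Xx Xy]]]].
  exists x, y; split; try by apply: sX; rewrite !inE eqxx ?orbT.
  by move=> xy; move: us; rewrite xy inE eqxx.
exists [:: x; y]; split=> //= [|z]; first by rewrite inE andbT; apply/eqP.
by rewrite !inE => /orP[] /eqP ->.
Qed.

(** Two nilpotent maps u and v with v = u - 1 on the orbit of y can only meet
    at y = 0: on the last nonzero iterate z of y under u, the map v acts as
    the bijection z -> - z. *)
Lemma nilpotent_shift0 (V : zmodType) (u v : V -> V) (y : V) (m n : nat) :
    (forall z, v (- z) = - v z) ->
    (forall k, v (iter k u y) = iter k.+1 u y - iter k u y) ->
    iter m u y = 0 -> (forall k, iter n v (iter k u y) = 0) ->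
  y = 0.
Proof.
move=> vN vu um vn; have ex : exists k, iter k u y == 0 by exists m; apply/eqP.
case: (ex_minnP ex) => [[|k] /eqP // uk kmin].
have vz : v (iter k u y) = - iter k u y by rewrite vu uk sub0r.
have vj j : iter j v (iter k u y) = iter k u y \/
            iter j v (iter k u y) = - iter k u y.
  by elim: j => [|j [] IH] /=; [left | right | left];
    rewrite ?IH ?vN ?vz ?opprK.
have /kmin : iter k u y == 0; last by rewrite ltnn.
by case: (vj n); rewrite vn => /esym /eqP //; rewrite oppr_eq0.
Qed.

Lemma idempotentsC (R : pzRingType) (e : R) :
  idempotents e -> idempotents (1 - e).
Proof.
rewrite /idempotents /= => he.
by rewrite mulrBl mul1r mulrBr mulr1 he subrr subr0.
Qed.

Lemma idemMC (R : pzRingType) (e : R) : idempotents e -> e * (1 - e) = 0.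
Proof. by rewrite /idempotents /= => he; rewrite mulrBr mulr1 he subrr. Qed.

Lemma idemCM (R : pzRingType) (e : R) : idempotents e -> (1 - e) * e = 0.
Proof. by rewrite /idempotents /= => he; rewrite mulrBl mul1r he subrr. Qed.

Lemma nilpotentsN (R : pzRingType) (x : R) : nilpotents x -> nilpotents (- x).
Proof. by move=> [n xn]; exists n; rewrite exprNn xn mulr0. Qed.

Lemma eta_setC (R : pzRingType) (a e : R) :
  eta_set a e -> eta_set (1 - a) (1 - e).
Proof.
move=> [he /nilpotentsN hae]; split; first exact: idempotentsC.
by rewrite opprB addrC subrKA -opprB.
Qed.

(** If two idempotents e, e' of the abelian ring R lie over the same a, then
    on the ideal generated by e (1 - e') the nilpotent elements a - e' and
    a - e differ by 1, so that this ideal vanishes. *)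
Lemma abelian_Nin (R : pzRingType) :
  (forall e x : R, idempotents e -> e * x * (1 - e) = 0) -> ~ Nin_ge R 2.
Proof.
move=> abR.
have cR (e x : R) : idempotents e -> e * x = x * e.
  move=> he; have := abR _ x he; rewrite mulrBr mulr1 => /subr0_eq ->.
  have := abR _ x (idempotentsC he); rewrite subKr mulrBl mul1r mulrBl.
  by move=> /subr0_eq <-.
have absorb (a e e' : R) : eta_set a e -> eta_set a e' -> e = e * e'.
  move=> [he [n hn]] [he' [m hm]]; set y := e * (1 - e').
  have itM (c z : R) k : iter k ( *%R c) z = c ^+ k * z.
    by elim: k => [|k /= ->]; rewrite ?expr0 ?mul1r // exprS mulrA.
  have ey : e * y = y by rewrite mulrA he.
  have e'y : e' * y = 0 by rewrite cR // -mulrA idemCM // mulr0.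
  suff : y = 0 by rewrite /y mulrBr mulr1 => /subr0_eq.
  apply: (@nilpotent_shift0 _ ( *%R (a - e')) ( *%R (a - e)) y m n).
  - by move=> z; rewrite mulrN.
  - move=> k; rewrite iterS !itM.
    set z := (a - e') ^+ k.
    have -> : a - e = (a - e') + (e' - e) by rewrite addrA subrK.
    rewrite mulrDl; congr (_ + _).
    rewrite mulrBl !mulrA (cR e' z) // (cR e z) // -!mulrA e'y ey.
    by rewrite mulr0 sub0r.
  - by rewrite itM hm mul0r.
  - by move=> k; rewrite itM hn mul0r.
move=> [a /at_least2P[e [e' [ee' he he']]]]; apply: ee'.
by rewrite (absorb _ _ _ he he') (cR e e' he.1) -(absorb _ _ _ he' he).
Qed.

(** * Idempotents of a formal triangular matrix ring *)

Section Bimodule.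
Variables (A B : pzRingType) (M : bimodType A B).
Implicit Types (a e : A) (b f : B) (x y : M).

Lemma ract0r b : (0 : M) :*> b = 0.
Proof. by apply: (addrI ((0 : M) :*> b)); rewrite -ractDl !addr0. Qed.

Lemma ractr0 x : x :*> (0 : B) = 0.
Proof. by apply: (addrI (x :*> 0)); rewrite -ractDr !addr0. Qed.

Lemma ractNl x b : (- x) :*> b = - (x :*> b).
Proof. by apply/eqP; rewrite -addr_eq0 -ractDl addNr ract0r. Qed.

Lemma ractNr x b : x :*> (- b) = - (x :*> b).
Proof. by apply/eqP; rewrite -addr_eq0 -ractDr addNr ractr0. Qed.

(** The projection of M onto e M (1 - f) + (1 - e) M f along
    e M f + (1 - e) M (1 - f). *)
Definition offproj e f x := e *: x :*> (1 - f) + (1 - e) *: x :*> f.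

Lemma offprojD e f : {morph offproj e f : x y / x + y}.
Proof. by move=> x y; rewrite /offproj !scalerDr !ractDl addrACA. Qed.

Lemma offprojE e f x :
  offproj e f x = e *: x + x :*> f - (e *: x :*> f + e *: x :*> f).
Proof.
rewrite /offproj scalerBl scale1r ractDr ract1 ractNr ractDl ractNl.
by rewrite addrACA opprD.
Qed.

Lemma offprojCl e f x : offproj (1 - e) f x = x - offproj e f x.
Proof.
apply/eqP; rewrite eq_sym subr_eq eq_sym /offproj subKr addrACA.
by rewrite -!ractDl -!scalerDl subrK subrKC !scale1r -ractDr subrK ract1.
Qed.

Lemma offprojCr e f x : offproj e (1 - f) x = x - offproj e f x.
Proof.
apply/eqP; rewrite eq_sym subr_eq eq_sym /offproj subKr addrACA.
by rewrite -!ractDr subrK subrKC !ract1 -scalerDl subrKC scale1r.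
Qed.

Lemma offproj_idem e f x : idempotents e -> idempotents f ->
  offproj e f (offproj e f x) = offproj e f x.
Proof.
move=> he hf; rewrite {1}/offproj /offproj !scalerDr !ractDl.
rewrite !scale_ractA !scalerA -!ractA he (idempotentsC he) hf.
rewrite (idempotentsC hf) idemMC // (idemCM he) (idemMC hf) !(idemCM hf).
by rewrite !scale0r !ract0r addr0 add0r.
Qed.

(** Multiplying x = e x + x f by e shows that e x f = 0. *)
Lemma offproj_fixP e f x : idempotents e -> idempotents f ->
  e *: x + x :*> f = x <-> offproj e f x = x.
Proof.
move=> he hf; suff h : e *: x + x :*> f = x \/ offproj e f x = x ->
    e *: x :*> f = 0.
  by split=> hx; move: (hx); rewrite offprojE h ?addr0 ?subr0; auto.
move=> [hx|hx].
  have := congr1 (fun z => e *: z) hx.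
  rewrite scalerDr scalerA he scale_ractA => /eqP.
  by rewrite -subr_eq0 addrAC subrr add0r => /eqP.
rewrite -hx /offproj scalerDr ractDl !scale_ractA !scalerA -!ractA.
by rewrite (idemCM hf) (idemMC he) ractr0 scale0r !ract0r addr0.
Qed.

Lemma offdiagE e f : idempotents e -> idempotents f ->
  offdiag M e f = [set x | offproj e f x = x].
Proof.
move=> he hf; apply/seteqP; split=> [_ [x _ [y _ <-]]|x /= hx]; last first.
  by exists x => //; exists x.
rewrite /= {1}/offproj !scalerDr !ractDl.
rewrite !scale_ractA !scalerA -!ractA he (idempotentsC he) hf.
rewrite (idempotentsC hf) idemMC // (idemCM he) (idemMC hf) !(idemCM hf).
by rewrite !scale0r !ract0r addr0 add0r.
Qed.

Lemma offproj10 x : offproj 1 0 x = x.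
Proof. by rewrite /offproj subrr scale0r ract0r addr0 scale1r subr0 ract1. Qed.

Lemma trimx_exp (u : trimx M) n :
  ulmx (u ^+ n) = ulmx u ^+ n /\ drmx (u ^+ n) = drmx u ^+ n.
Proof.
elim: n => [|n [IH1 IH2]]; first by rewrite !expr0.
by rewrite !exprS -IH1 -IH2.
Qed.

(** The strictly triangular matrices square to zero. *)
Lemma trimx_nilpotent (u : trimx M) :
  nilpotents u <-> nilpotents (ulmx u) /\ nilpotents (drmx u).
Proof.
split=> [[n un]|[[m um] [n un]]].
  by have [hl hr] := trimx_exp u n; split; exists n; rewrite -?hl -?hr un.
exists ((m + n) * 2)%N; rewrite exprM expr2.
have [] := trimx_exp u (m + n); rewrite !exprD um un mul0r mulr0.
rewrite -exprD; case: (u ^+ (m + n)) => a x b /= -> ->.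
by rewrite /GRing.mul /= /trimx_mul /= !mul0r scale0r ractr0 addr0.
Qed.

Lemma trimx_eta (u v : trimx M) :
  eta_set u v <-> [/\ eta_set (ulmx u) (ulmx v), eta_set (drmx u) (drmx v)
                    & offproj (ulmx v) (drmx v) (urmx v) = urmx v].
Proof.
case: u v => [a w b] [e x f] /=; split=> [[hv /trimx_nilpotent[ha hb]]|].
  case: hv => he hx hf; split; [by split | by split |].
  by apply/offproj_fixP.
move=> [[he ha] [hf hb] /offproj_fixP hx].
split; last by apply/trimx_nilpotent.
by rewrite /idempotents /= /GRing.mul /= /trimx_mul /= he hf hx.
Qed.

End Bimodule.

(** V is the direct sum of the images of p and q = 1 - p. *)
Lemma count_complement (V : zmodType) (s : seq V) (p q : V -> V) :
    uniq s -> (forall x, x \in s) ->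
    {morph p : x y / x + y} -> (forall x, p (p x) = p x) ->
    (forall x, q x = x - p x) ->
  (count (fun x => p x == x) s * count (fun x => q x == x) s)%N = size s.
Proof.
move=> us sV pD pp qE.
have p0 : p 0 = 0 by apply: (addrI (p 0)); rewrite -pD !addr0.
have fixq x : (q x == x) = (p x == 0).
  by rewrite qE -subr_eq0 addrAC subrr add0r oppr_eq0.
rewrite -!size_filter -(size_allpairs (fun x y => x + y)).
apply: perm_size; apply: uniq_perm => // [|x]; last first.
  rewrite [RHS]sV; apply/allpairsP; exists (p x, x - p x) => /=.
  rewrite !mem_filter !sV fixq pp eqxx subrKC; split=> //.
  have := pD (x - p x) (p x); rewrite subrK pp => /eqP.
  by rewrite -subr_eq subrr eq_sym => ->.
apply: allpairs_uniq; rewrite ?filter_uniq // => -[x y] [x' y'] /=.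
move=> /allpairsPdep[x1 [y1 [+ + [-> ->]]]] /allpairsPdep[x2 [y2 [+ + [-> ->]]]].
rewrite !mem_filter !fixq => /andP[/eqP px _] /andP[/eqP py _].
move=> /andP[/eqP px' _] /andP[/eqP py' _] e.
have := congr1 p e; rewrite !pD px px' py py' !addr0 => xx'.
by move: e; rewrite xx' => /addrI ->.
Qed.

(** The clean decompositions of a triangular matrix over those, e and f, of
    its diagonal entries form a fiber in bijection with the subgroup
    e M (1 - f) + (1 - e) M f. When s lists M, the weight is the order of this
    subgroup. *)
Definition weight (A B : pzRingType) (M : bimodType A B) (s : seq M)
    (e : A) (f : B) :=
  count (fun x => offproj e f x == x) s.

Definition total_weight (A B : Type) (c : A -> B -> nat) (s : seq A)
    (t : seq B) :=
  (\sum_(e <- s) \sum_(f <- t) c e f)%N.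

(** The abstract form of the inequality n <= Nin R, where the pair (e, f) of
    idempotents of A and B counts with multiplicity c e f. *)
Definition weight_ge (A B : pzRingType) (c : A -> B -> nat) (n : nat) :=
  exists (a : A) (b : B) (s : seq A) (t : seq B),
    [/\ uniq s /\ forall e, e \in s -> eta_set a e,
        uniq t /\ forall f, f \in t -> eta_set b f
      & (n <= total_weight c s t)%N].

Section Fibers.
Variables (A B : pzRingType) (M : bimodType A B) (sM : seq M).
Hypotheses (usM : uniq sM) (sMP : forall x, x \in sM).

(** The set of decompositions of u is listed fiber by fiber. *)
Lemma trimx_at_least (u : trimx M) n :
  at_least n (eta_set u) <->
  exists (s : seq A) (t : seq B),
    [/\ uniq s /\ forall e, e \in s -> eta_set (ulmx u) e,
        uniq t /\ forall f, f \in t -> eta_set (drmx u) f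
      & (n <= total_weight (weight sM) s t)%N].
Proof.
pose F (p : A * B) := [seq x <- sM | offproj p.1 p.2 x == x].
pose L (s : seq A) (t : seq B) :=
  [seq TriMx p.1 x p.2 | p <- [seq (e, f) | e <- s, f <- t], x <- F p].
have sL s t : size (L s t) = total_weight (weight sM) s t.
  rewrite size_allpairs_dep sumnE big_map big_allpairs.
  by apply: eq_bigr => e _; apply: eq_bigr => f _; rewrite size_filter.
have memL s t z : (z \in L s t) = [&& ulmx z \in s, drmx z \in t
    & offproj (ulmx z) (drmx z) (urmx z) == urmx z].
  apply/allpairsPdep/and3P => [[_ [x [/allpairsP[[e f] [/= es ft ->]]]]]|].
    by rewrite mem_filter => /andP[hx _] ->.
  move=> [hs ht hz]; exists (ulmx z, drmx z), (urmx z).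
  split; last by case: z {hs ht hz}.
    by apply/allpairsP; exists (ulmx z, drmx z).
  by rewrite mem_filter hz sMP.
have uL s t : uniq s -> uniq t -> uniq (L s t).
  move=> us ut; apply: allpairs_uniq_dep.
  - by apply: allpairs_uniq => // -[? ?] [? ?] _ _ [-> ->].
  - by move=> p _; rewrite filter_uniq.
  - by move=> [[e f] x] [[e' f'] x'] _ _ [-> -> ->].
split=> [[l [ul nl lu]]|[s [t [[us su] [ut tu] nst]]]].
  exists (undup (map (@ulmx _ _ _) l)), (undup (map (@drmx _ _ _) l)).
  split.
  - split; first exact: undup_uniq.
    by move=> e; rewrite mem_undup => /mapP[z /lu /trimx_eta[hz _ _] ->].
  - split; first exact: undup_uniq.
    by move=> e; rewrite mem_undup => /mapP[z /lu /trimx_eta[_ hz _] ->].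
  rewrite -sL; apply: leq_trans nl _; apply: uniq_leq_size => // z zl.
  rewrite memL !mem_undup !map_f //.
  by have /trimx_eta[_ _ ->] := lu z zl; rewrite eqxx.
exists (L s t); split; rewrite ?sL ?uL // => z.
rewrite memL => /and3P[/su hs /tu ht /eqP hz].
by apply/trimx_eta.
Qed.

Lemma trimx_Nin_ge n : Nin_ge (trimx M) n <-> weight_ge (weight sM) n.
Proof.
split=> [[u /trimx_at_least hu]|[a [b h]]].
  by exists (ulmx u), (drmx u).
by exists (TriMx a 0 b); apply/trimx_at_least.
Qed.

Lemma weightCl e f : idempotents e -> idempotents f ->
  (weight sM e f * weight sM (1 - e) f)%N = size sM.
Proof.
move=> he hf; apply: count_complement => //; first exact: offprojD.
  by move=> x; exact: offproj_idem.
exact: offprojCl.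
Qed.

Lemma weightCr e f : idempotents e -> idempotents f ->
  (weight sM e f * weight sM e (1 - f))%N = size sM.
Proof.
move=> he hf; apply: count_complement => //; first exact: offprojD.
  by move=> x; exact: offproj_idem.
exact: offprojCr.
Qed.

Lemma weight10 : weight sM 1 0 = size sM.
Proof.
by apply/eqP; rewrite -all_count; apply/allP => x _; rewrite offproj10.
Qed.

Lemma weight1P e f : idempotents e -> idempotents f ->
  weight sM e f = 1%N <-> offdiag M e f = [set 0].
Proof.
move=> he hf; rewrite offdiagE //.
have h0 : offproj e f (0 : M) = 0.
  by apply: (addrI (offproj e f 0)); rewrite -offprojD !addr0.
split=> [|hF]; last first.
  have <- : count_mem 0 sM = 1%N by rewrite count_uniq_mem ?sMP.
  apply: eq_count => x /=.
  have hx : (offproj e f x = x) = (x = 0) := congr1 (fun X : set M => X x) hF.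
  by apply/eqP/eqP; rewrite hx.
rewrite /weight -size_filter => hF; apply/seteqP; split=> x /=; last by move->.
move=> hx; have memF y : offproj e f y = y ->
    y \in [seq z <- sM | offproj e f z == z].
  by move=> hy; rewrite mem_filter hy eqxx sMP.
move: (memF _ hx) (memF _ h0) hF.
case: [seq z <- sM | _] => [|y [|z F]] //=.
by rewrite !inE => /eqP -> /eqP ->.
Qed.

End Fibers.

(** * Total weights of pairs of clean decompositions *)

Lemma sum_const_seq (T : Type) (s : seq T) (n : nat) :
  (\sum_(x <- s) n = size s * n)%N.
Proof. by rewrite big_const_seq count_predT iter_addn_0 mulnC. Qed.

Lemma factor4 (x y : nat) : (x * y = 4)%N ->
  [\/ x = 1 /\ y = 4, x = 2 /\ y = 2 | x = 4 /\ y = 1]%N.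
Proof.
move=> xy; have : (x <= 4)%N by apply: dvdn_leq => //; rewrite -xy dvdn_mulr.
by move: xy; case: x => [|[|[|[|[|//]]]]] xy _;
  [lia | apply: Or31 | apply: Or32 | lia | apply: Or33]; lia.
Qed.

Section Weights.
Variables (A B : pzRingType) (c : A -> B -> nat) (m : nat).
Hypothesis cCl : forall e f, idempotents e -> idempotents f ->
  (c e f * c (1 - e) f)%N = m.

Lemma weight_ge_swap n :
  weight_ge c n <-> weight_ge (fun f e => c e f) n.
Proof.
by split=> -[a [b [s [t [hs ht]]]]]; rewrite /total_weight exchange_big => hn;
  exists b, a, t, s.
Qed.

Lemma compl_list (a : A) (s : seq A) :
    uniq s /\ (forall e, e \in s -> eta_set a e) ->
  uniq [seq 1 - e | e <- s] /\
  forall e, e \in [seq 1 - e | e <- s] -> eta_set (1 - a) e.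
Proof.
move=> [us sa]; split=> [|_ /mapP[e /sa he ->]]; last exact: eta_setC.
by rewrite map_inj_uniq // => x y /addrI /oppr_inj.
Qed.

(** A lower bound for the weight over a and 1 - a together: two numbers of
    product 4 add up to at least 4. *)
Lemma total_weight_compl (s : seq A) (t : seq B) : m = 4%N ->
    (forall e, e \in s -> idempotents e) ->
    (forall f, f \in t -> idempotents f) ->
  (4 * (size s * size t) <=
   total_weight c s t + total_weight c [seq (1 - e)%R | e <- s] t)%N.
Proof.
move=> m4 hs ht; rewrite /total_weight big_map -big_split /=.
apply: (@leq_trans (\sum_(e <- s) \sum_(f <- t) 4)%N).
  by rewrite !sum_const_seq; lia.
rewrite big_seq [leqRHS]big_seq; apply: leq_sum => e /hs he.
rewrite -big_split /= big_seq [leqRHS]big_seq; apply: leq_sum => f /ht hf.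
by have := cCl he hf; rewrite m4 => /factor4[] [-> ->].
Qed.

(** When the weight is constant over each pair (a, b), it is m or 1, and
    passing from a to 1 - a exchanges these two values. *)
Lemma prime_weight_ge : prime m ->
    (forall a b e e' f f', eta_set a e -> eta_set a e' ->
       eta_set b f -> eta_set b f' -> c e f = c e' f') ->
  forall n, weight_ge c n <->
    exists i j, [/\ Nin_ge A i, Nin_ge B j & (n <= m * (i * j))%N].
Proof.
move=> pm cst n; have c1m e f : idempotents e -> idempotents f ->
    c e f = 1%N \/ c e f = m.
  move=> he hf; have := cCl he hf => h.
  have : (c e f %| m)%N by rewrite -h dvdn_mulr.
  by move/primeP: pm => [_ h']; move/h' => /orP[] /eqP; auto.
split=> [[a [b [s [t [[us sa] [ut tb] hn]]]]]|].
  exists (size s), (size t); split; [by exists a, s | by exists b, t |].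
  apply: leq_trans hn _.
  apply: (@leq_trans (\sum_(e <- s) \sum_(f <- t) m)%N); last first.
    by rewrite !sum_const_seq; lia.
  rewrite /total_weight big_seq [leqRHS]big_seq; apply: leq_sum => e /sa [he _].
  rewrite big_seq [leqRHS]big_seq; apply: leq_sum => f /tb [hf _].
  by case: (c1m e f he hf) => ->; rewrite ?prime_gt0.
move=> [i [j [[a [s [us si sa]]] [b [t [ut tj tb]]] hn]]].
have hst : (n <= m * (size s * size t))%N.
  by apply: leq_trans hn _; rewrite leq_mul2l leq_mul ?orbT.
have full (a' : A) (s' : seq A) :
    uniq s' /\ (forall e, e \in s' -> eta_set a' e) ->
    size s' = size s -> (forall e f, e \in s' -> f \in t -> c e f = m) ->
    weight_ge c n.
  move=> hs' ss' cm; exists a', b, s', t; split=> //; apply: leq_trans hst _.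
  rewrite -ss' /total_weight.
  apply: (@leq_trans (\sum_(e <- s') \sum_(f <- t) m)%N).
    by rewrite !sum_const_seq; lia.
  rewrite big_seq [leqRHS]big_seq; apply: leq_sum => e es.
  by rewrite big_seq [leqRHS]big_seq; apply: leq_sum => f ft; rewrite cm.
have [h|h] := pselect (forall e f, e \in s -> f \in t -> c e f = m).
  exact: (full a s (conj us sa) erefl h).
apply: (full (1 - a) [seq 1 - e | e <- s]); first exact: compl_list.
  by rewrite size_map.
move=> _ f /mapP[e es ->] ft.
have [he _] := sa e es; have [hf _] := tb f ft.
have := cCl he hf; suff -> : c e f = 1%N by rewrite mul1n.
case: (c1m e f he hf) => // cm; case: h => e' f' es' ft'.
by rewrite -cm; apply: (cst a b); auto.
Qed.

(** With f and a second element f' over b, the sums c e f + c e f' and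
    c (1 - e) f + c (1 - e) f' are at most 4; a value c e f = 1 would make
    c (1 - e) f = 4 and leave no room for f'. *)
Lemma weight_condition : m = 4%N -> ~ weight_ge c 5 ->
  forall e b f, idempotents e -> at_least 2 (eta_set b) -> eta_set b f ->
    c e f <> 1%N.
Proof.
move=> m4 c5 e b f he /at_least2P[f1 [f2 [f12 hf1 hf2]]] hf.
have [f' f'f hf'] : exists2 f', f' != f & eta_set b f'.
  have [ff1|] := eqVneq f1 f; last by exists f1.
  by exists f2 => //; rewrite -ff1; apply/eqP => /esym.
have bound e' : idempotents e' -> (c e' f + c e' f' <= 4)%N.
  move=> he'; rewrite leqNgt; apply/negP => h; apply: c5.
  exists e', b, [:: e'], [:: f; f']; split.
  - by split=> // x; rewrite inE => /eqP ->; exact: eta_set_id.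
  - split=> [|x]; first by rewrite /= inE eq_sym f'f.
    by rewrite !inE => /orP[] /eqP ->.
  - by rewrite /total_weight !big_cons !big_nil !addn0.
have := bound _ he; have := bound _ (idempotentsC he).
have := cCl he hf.1; have := cCl he hf'.1; rewrite m4.
by move=> /factor4[] [-> ->] /factor4[] [-> ->]; lia.
Qed.

(** The condition excludes the value 1 at e and at 1 - e, hence leaves only 2;
    the two decompositions of b then contribute 2 + 2. *)
Lemma weight_lt5 : m = 4%N -> ~ Nin_ge A 2 -> ~ Nin_ge B 3 ->
    (forall e b f, idempotents e -> at_least 2 (eta_set b) -> eta_set b f ->
       c e f <> 1%N) ->
  ~ weight_ge c 5.
Proof.
move=> m4 A2 B3 cond [a [b [s [t [[us sa] [ut tb]]]]]].
apply/negP; rewrite -leqNgt.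
have : (size s <= 1)%N.
  by rewrite leqNgt; apply/negP => h; apply: A2; exists a, s.
have : (size t <= 2)%N.
  by rewrite leqNgt; apply/negP => h; apply: B3; exists b, t.
case: s us sa => [|e [|//]] us sa; first by rewrite /total_weight big_nil.
have [he _] := sa e (mem_head _ _).
case: t ut tb => [|f [|f' [|//]]] ut tb _ _;
    rewrite /total_weight !(big_cons, big_nil) ?addn0 //.
  have [hf _] := tb f (mem_head _ _).
  by have := cCl he hf; rewrite m4 => /factor4[] [-> _].
have bf : eta_set b f by apply: tb; rewrite inE eqxx.
have bf' : eta_set b f' by apply: tb; rewrite !inE eqxx orbT.
have b2 : at_least 2 (eta_set b) by exists [:: f; f'].
have := cond _ _ _ he b2 bf; have := cond _ _ _ (idempotentsC he) b2 bf.
have := cond _ _ _ he b2 bf'; have := cond _ _ _ (idempotentsC he) b2 bf'.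
have := cCl he bf.1; have := cCl he bf'.1; rewrite m4.
by move=> /factor4[] [-> ->] /factor4[] [-> ->]; lia.
Qed.

(** The weights over (a, b) and (1 - a, b) are at most 4 each, and together at
    least 4 times the number of pairs of decompositions. *)
Lemma weight_lt5_Nin : m = 4%N -> ~ weight_ge c 5 ->
  forall i j, Nin_ge A i -> Nin_ge B j -> (i * j <= 2)%N.
Proof.
move=> m4 c5 i j [a [s [us si sa]]] [b [t [ut tj tb]]].
have bound a' s' : uniq s' /\ (forall e, e \in s' -> eta_set a' e) ->
    (total_weight c s' t <= 4)%N.
  move=> hs'; rewrite leqNgt; apply/negP => h; apply: c5.
  by exists a', b, s', t.
have h1 := bound a s (conj us sa).
have h2 := bound _ _ (compl_list (conj us sa)).
have := total_weight_compl m4 (fun e es => (sa e es).1)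
  (fun f ft => (tb f ft).1).
move=> /leq_trans /(_ (leq_add h1 h2)); rewrite -[(4 + 4)%N]/(4 * 2)%N.
by rewrite leq_pmul2l //; exact: leq_trans (leq_mul si tj).
Qed.

End Weights.

(** Both indices cannot exceed 1; the one which does is then 2, and it forces
    the weights of its decompositions to be all equal to 2. *)
Lemma weight4P (A B : pzRingType) (c : A -> B -> nat) :
    (forall e f, idempotents e -> idempotents f ->
       (c e f * c (1 - e)%R f)%N = 4%N) ->
    (forall e f, idempotents e -> idempotents f ->
       (c e f * c e (1 - f)%R)%N = 4%N) ->
  ~ weight_ge c 5 <->
  [\/ ~ Nin_ge A 2 /\ ~ Nin_ge B 2,
      [/\ ~ Nin_ge A 2, Nin_ge B 2 /\ ~ Nin_ge B 3 &
          forall e b f, idempotents e -> at_least 2 (eta_set b) ->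
            eta_set b f -> c e f <> 1%N]
    | [/\ ~ Nin_ge B 2, Nin_ge A 2 /\ ~ Nin_ge A 3 &
          forall a e f, idempotents f -> at_least 2 (eta_set a) ->
            eta_set a e -> c e f <> 1%N]].
Proof.
move=> cCl cCr; have cCr' f e : idempotents f -> idempotents e ->
  (c e f * c e (1 - f)%R)%N = 4%N by move=> hf he; exact: cCr.
have not23 R : ~ Nin_ge R 2 -> ~ Nin_ge R 3.
  by move=> R2 R3; apply: R2; exact: Nin_ge_leq R3.
have no2 R a : ~ Nin_ge R 2 -> ~ at_least 2 (@eta_set R a).
  by move=> R2 Ra; apply: R2; exists a.
split=> [c5|[[A2 B2]|[A2 [B2 B3] cond]|[B2 [A2 A3] cond]]].
- have mul := weight_lt5_Nin cCl erefl c5.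
  have [A2|A2] := pselect (Nin_ge A 2); have [B2|B2] := pselect (Nin_ge B 2).
  + by have := mul _ _ A2 B2.
  + have c5' : ~ weight_ge (fun f e => c e f) 5 by move/weight_ge_swap.
    apply: Or33; split=> // [|a e f hf ha].
      by split=> // A3; have := mul _ _ A3 (Nin_ge1 B).
    exact: (weight_condition cCr' erefl c5' hf ha).
  + apply: Or32; split=> // [|e b f]; last exact: (weight_condition cCl).
    by split=> // B3; have := mul _ _ (Nin_ge1 A) B3.
  + exact: Or31.
- apply: (weight_lt5 cCl) => // [|e b f _ /no2]; first exact: not23.
  by move=> /(_ B2).
- exact: (weight_lt5 cCl).
- move/weight_ge_swap; apply: (weight_lt5 cCr') => // f a e.
  by move=> hf a2 ae; exact: cond a2 ae.
Qed.

(** * Bimodules of prime order *)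

(** A group of prime order is indecomposable, so p and q are each 0 or the
    identity; were they different, al and al - 1 would both be nilpotent. *)
Lemma prime_idem_endo (V : zmodType) (s : seq V) (al p q : V -> V) (m n : nat) :
    uniq s -> (forall x, x \in s) -> prime (size s) ->
    {morph al : x y / x + y} -> {morph p : x y / x + y} ->
    {morph q : x y / x + y} ->
    (forall x, p (p x) = p x) -> (forall x, q (q x) = q x) ->
    (forall x, iter m (fun z => al z - p z) x = 0) ->
    (forall x, iter n (fun z => al z - q z) x = 0) ->
  p =1 q.
Proof.
move=> us sV pr alD pD qD pp qq pm qn.
have dich (r : V -> V) : {morph r : x y / x + y} -> (forall x, r (r x) = r x) ->
    (forall x, r x = 0) \/ (forall x, r x = x).
  move=> rD rr; have := count_complement us sV rD rr (fun=> erefl) => cnt.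
  have all_fix (g : V -> V) : count (fun x => g x == x) s = size s ->
      forall x, g x = x.
    by move=> /eqP; rewrite -all_count => /allP h x; apply/eqP/h.
  have : (count (fun x => r x == x) s %| size s)%N by rewrite -cnt dvdn_mulr.
  move/primeP: (pr) => [_ h'] /h' /orP[] /eqP h; last by right; exact: all_fix.
  left=> x; move: cnt; rewrite h mul1n => /all_fix /(_ x) /eqP.
  by rewrite -subr_eq0 addrAC subrr add0r oppr_eq0 => /eqP.
have oppD (r : V -> V) : {morph r : x y / x + y} -> forall z, r (- z) = - r z.
  move=> rD z; apply/eqP; rewrite -addr_eq0 -rD addNr.
  by apply/eqP/(addrI (r 0)); rewrite -rD !addr0.
have key (p' q' : V -> V) m' n' : {morph q' : x y / x + y} ->
    (forall x, p' x = 0) -> (forall x, q' x = x) ->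
    (forall x, iter m' (fun z => al z - p' z) x = 0) ->
    (forall x, iter n' (fun z => al z - q' z) x = 0) -> forall x : V, x = 0.
  move=> q'D p0 q1 pm' qn' x.
  apply: (@nilpotent_shift0 _ (fun z => al z - p' z)
    (fun z => al z - q' z) x m' n').
  - by move=> z; rewrite (oppD al alD) (oppD q' q'D) opprD.
  - by move=> k; rewrite /= p0 q1 subr0.
  - exact: pm'.
  - by move=> k; exact: qn'.
case: (dich p pD pp) (dich q qD qq) => hp [] hq x; rewrite hp hq //.
  by rewrite (key _ _ _ _ qD hp hq pm qn x).
exact: (key _ _ _ _ pD hq hp qn pm x).
Qed.

Section PrimeOrder.
Variables (A B : pzRingType) (M : bimodType A B) (sM : seq M).
Hypotheses (usM : uniq sM) (sMP : forall x, x \in sM).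

Lemma prime_left_action (a e e' : A) : prime (size sM) ->
  eta_set a e -> eta_set a e' -> forall x : M, e *: x = e' *: x.
Proof.
move=> pr [he [m hm]] [he' [n hn]].
have it (g : A) k : (a - g) ^+ k = 0 ->
    forall x : M, iter k (fun z => a *: z - g *: z) x = 0.
  move=> gk x.
  suff -> : iter k (fun z => a *: z - g *: z) x = (a - g) ^+ k *: x.
    by rewrite gk scale0r.
  elim: k {gk} => [|k IH]; first by rewrite expr0 scale1r.
  by rewrite iterS IH exprS -scalerBl scalerA.
apply: (@prime_idem_endo M sM (fun z => a *: z) (fun z => e *: z)
  (fun z => e' *: z) m n) => //; try exact: scalerDr; try exact: it.
- by move=> x; rewrite scalerA he.
- by move=> x; rewrite scalerA he'.
Qed.

Lemma prime_right_action (b f f' : B) : prime (size sM) ->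
  eta_set b f -> eta_set b f' -> forall x : M, x :*> f = x :*> f'.
Proof.
move=> pr [hf [m hm]] [hf' [n hn]].
have it (g : B) k : (b - g) ^+ k = 0 ->
    forall x : M, iter k (fun z => z :*> b - z :*> g) x = 0.
  move=> gk x.
  suff -> : iter k (fun z => z :*> b - z :*> g) x = x :*> (b - g) ^+ k.
    by rewrite gk ractr0.
  elim: k {gk} => [|k IH]; first by rewrite expr0 ract1.
  by rewrite iterS IH exprSr -ractNr -ractDr ractA.
apply: (@prime_idem_endo M sM (fun z => z :*> b) (fun z => z :*> f)
  (fun z => z :*> f') m n) => //; try (by move=> x y; rewrite ractDl);
  try exact: it.
- by move=> x; rewrite -ractA hf.
- by move=> x; rewrite -ractA hf'.
Qed.

(** This is the formula Nin (trimx M) = |M| Nin A Nin B, written with lower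
    bounds so as to cover infinite indices. *)
Lemma trimx_prime_Nin_ge n : prime (size sM) ->
  Nin_ge (trimx M) n <->
  exists i j, [/\ Nin_ge A i, Nin_ge B j & (n <= size sM * (i * j))%N].
Proof.
move=> pr; rewrite (trimx_Nin_ge usM sMP).
apply: prime_weight_ge => // [e f he hf|a b e e' f f' he he' hf hf'].
  exact: weightCl.
apply: eq_count => x; rewrite !offprojE.
rewrite !(prime_left_action pr he he') !(prime_right_action pr hf hf').
by [].
Qed.

Lemma trimx_order2_Nin4P : size sM = 2%N ->
  Nin (trimx M) = 4%:E <-> (Nin A * Nin B = 2%:E)%E.
Proof.
move=> s2; have pr : prime (size sM) by rewrite s2.
rewrite Nin_mul2P !Nin2_geP !Nin1P Nin4_geP !(trimx_prime_Nin_ge _ pr) s2.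
split=> [[[i [j [Ai Bj ij]]] N5]|].
  have mul i' j' : Nin_ge A i' -> Nin_ge B j' -> (2 * (i' * j') <= 4)%N.
    move=> Ai' Bj'; rewrite leqNgt; apply/negP => h.
    by apply: N5; exists i', j'.
  have [A2|A2] := pselect (Nin_ge A 2); [right | left]; split=> //.
  - by split=> // A3; have := mul _ _ A3 (Nin_ge1 B).
  - by move=> B2; have := mul _ _ A2 B2.
  - have i1 := Nin_ge_bound A2 Ai.
    split; first by apply: Nin_ge_leq Bj; nia.
    by move=> B3; have := mul _ _ (Nin_ge1 A) B3.
move=> [[A2 [B2 B3]]|[[A2 A3] B2]].
  split; first by exists 1%N, 2%N; split=> //; exact: Nin_ge1.
  move=> [i [j [Ai Bj]]].
  by have := leq_mul (Nin_ge_bound A2 Ai) (Nin_ge_bound B3 Bj); lia.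
split; first by exists 2%N, 1%N; split=> //; exact: Nin_ge1.
move=> [i [j [Ai Bj]]].
by have := leq_mul (Nin_ge_bound A3 Ai) (Nin_ge_bound B2 Bj); lia.
Qed.

(** 4 is not a multiple of 3. *)
Lemma trimx_order3_Nin : size sM = 3%N -> Nin (trimx M) <> 4%:E.
Proof.
move=> s3; have pr : prime (size sM) by rewrite s3.
rewrite Nin4_geP !(trimx_prime_Nin_ge _ pr) s3 => -[[i [j [Ai Bj ij]]]].
by apply; exists i, j; split=> //; lia.
Qed.

End PrimeOrder.

(** * Rings of nil clean index two *)

Lemma ecard_eqE (T : choiceType) (X : set T) (n : nat) :
  ecard X = n%:R%:E ->
  exists s : seq T, [/\ uniq s, size s = n & forall x, X x <-> x \in s].
Proof.
move=> eX; have /ecard_eqP[_ /bounded_list[s [us _ sX]]] := eX.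
exists s; split=> //; move: eX; rewrite (ecard_list us sX) => /eqP.
by rewrite eqe eqr_nat => /eqP.
Qed.

Lemma ring_iso_Nin_ge (R S : pzRingType) (n : nat) :
  ring_iso R S -> Nin_ge R n <-> Nin_ge S n.
Proof.
move=> [phi [psi phiK psiK]].
have phiI := can_inj phiK; have psiI := can_inj psiK.
have eta_phi a e : eta_set a e <-> eta_set (phi a) (phi e).
  rewrite /eta_set /idempotents /nilpotents /= -rmorphM -rmorphB.
  split=> -[he [m hm]]; split; try exists m.
  - by rewrite he.
  - by rewrite -rmorphXn hm rmorph0.
  - exact: phiI.
  - by apply: phiI; rewrite rmorphXn hm rmorph0.
split=> -[a ha]; [exists (phi a) | exists (psi a)].
  by apply: (at_least_image phiI _ ha) => x /eta_phi.
by apply: (at_least_image psiI _ ha) => x; rewrite eta_phi !psiK.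
Qed.

Record idem (R : pzRingType) := Idem { ival : R; ivalP : idempotents ival }.

(** The Peirce component e R f; for e = f, it is a ring with unity e. *)
Record corner (R : pzRingType) (e f : idem R) := Corner {
  cval : R;
  cvalP : ival e * cval * ival f == cval
}.

Section Corner.
Variable R : pzRingType.
Implicit Types e f g : idem R.

HB.instance Definition _ e f := [isSub for @cval R e f].
HB.instance Definition _ e f := [Choice of corner e f by <:].

Fact cut_subproof e f (x : R) :
  ival e * (ival e * x * ival f) * ival f == ival e * x * ival f.
Proof. by rewrite !mulrA (ivalP e) -!mulrA (ivalP f). Qed.

Definition cut e f (x : R) : corner e f := Corner (cut_subproof e f x).

Lemma cornerE e f (x : corner e f) : ival e * cval x * ival f = cval x.
Proof. exact/eqP/cvalP. Qed.

Lemma corner_l e f (x : corner e f) : ival e * cval x = cval x.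
Proof. by rewrite -(cornerE x) !mulrA (ivalP e). Qed.

Lemma corner_r e f (x : corner e f) : cval x * ival f = cval x.
Proof. by rewrite -(cornerE x) -!mulrA (ivalP f). Qed.

Lemma cutK e f (x : corner e f) : cut e f (cval x) = x.
Proof. by apply: val_inj; exact: cornerE. Qed.

Definition corner_zero e f := cut e f 0.
Definition corner_opp e f (x : corner e f) := cut e f (- cval x).
Definition corner_add e f (x y : corner e f) := cut e f (cval x + cval y).
Definition corner_one e := cut e e (ival e).
Definition corner_mul e f g (x : corner e f) (y : corner f g) : corner e g :=
  cut e g (cval x * cval y).

Lemma cval_add e f (x y : corner e f) :
  cval (corner_add x y) = cval x + cval y.
Proof. by rewrite /= mulrDr mulrDl !cornerE. Qed.

Lemma cval_mul e f g (x : corner e f) (y : corner f g) :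
  cval (corner_mul x y) = cval x * cval y.
Proof. by rewrite /= mulrA corner_l -mulrA corner_r. Qed.

Lemma cval_one e : cval (corner_one e) = ival e.
Proof. by rewrite /= !(ivalP e). Qed.

Fact corner_addA e f : associative (@corner_add e f).
Proof.
move=> x y z; apply: val_inj.
by rewrite [LHS]cval_add [RHS]cval_add !cval_add addrA.
Qed.

Fact corner_addC e f : commutative (@corner_add e f).
Proof. by move=> x y; rewrite /corner_add addrC. Qed.

Fact corner_add0 e f : left_id (corner_zero e f) (@corner_add e f).
Proof.
by move=> x; apply: val_inj; rewrite [LHS]cval_add /= mulr0 mul0r add0r.
Qed.

Fact corner_addN e f :
  left_inverse (corner_zero e f) (@corner_opp e f) (@corner_add e f).
Proof.
move=> x; apply: val_inj; rewrite [LHS]cval_add /= mulrN mulNr cornerE addNr.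
by rewrite mulr0 mul0r.
Qed.

HB.instance Definition _ e f := GRing.isZmodule.Build (corner e f)
  (@corner_addA e f) (@corner_addC e f) (@corner_add0 e f) (@corner_addN e f).

Lemma cvalD e f (x y : corner e f) : cval (x + y) = cval x + cval y.
Proof. exact: cval_add. Qed.

Fact corner_mulA e f g h (x : corner e f) (y : corner f g) (z : corner g h) :
  corner_mul x (corner_mul y z) = corner_mul (corner_mul x y) z.
Proof.
by apply: val_inj; rewrite [LHS]cval_mul [RHS]cval_mul !cval_mul mulrA.
Qed.

Fact corner_mul1l e f (x : corner e f) : corner_mul (corner_one e) x = x.
Proof. by apply: val_inj; rewrite [LHS]cval_mul cval_one corner_l. Qed.

Fact corner_mul1r e f (x : corner e f) : corner_mul x (corner_one f) = x.
Proof. by apply: val_inj; rewrite [LHS]cval_mul cval_one corner_r. Qed.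

Fact corner_mulDl e f g (x y : corner e f) (z : corner f g) :
  corner_mul (x + y) z = corner_mul x z + corner_mul y z.
Proof.
by apply: val_inj; rewrite [LHS]cval_mul [RHS]cvalD !cval_mul cvalD mulrDl.
Qed.

Fact corner_mulDr e f g (x : corner e f) (y z : corner f g) :
  corner_mul x (y + z) = corner_mul x y + corner_mul x z.
Proof.
by apply: val_inj; rewrite [LHS]cval_mul [RHS]cvalD !cval_mul cvalD mulrDr.
Qed.

HB.instance Definition _ e := GRing.Zmodule_isPzRing.Build (corner e e)
  (@corner_mulA e e e e) (@corner_mul1l e e) (@corner_mul1r e e)
  (@corner_mulDl e e e) (@corner_mulDr e e e).

HB.instance Definition _ e f := GRing.Zmodule_isLmodule.Build
  (corner e e) (corner e f)
  (fun a b v => @corner_mulA e e e f a b v) (@corner_mul1l e f)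
  (@corner_mulDr e e f) (fun v a b => @corner_mulDl e e f a b v).

HB.instance Definition _ e f := Lmodule_isBimodule.Build
  (corner e e) (corner f f) (corner e f)
  (fun x y b => @corner_mulDl e f f x y b)
  (fun x b c => @corner_mulDr e f f x b c)
  (fun x b c => @corner_mulA e f f f x b c)
  (@corner_mul1r e f)
  (fun a x b => @corner_mulA e e f f a x b).

Section Peirce.
Variables (e e' : idem R).
Hypothesis e'E : ival e' = 1 - ival e.
Hypothesis lower0 : forall x : R, ival e' * x * ival e = 0.

Let ee : ival e * ival e = ival e := ivalP e.
Let e'e' : ival e' * ival e' = ival e' := ivalP e'.
Let ee' : ival e * ival e' = 0.
Proof. by rewrite e'E idemMC //; exact: ivalP. Qed.
Let e'e : ival e' * ival e = 0.
Proof. by rewrite e'E idemCM //; exact: ivalP. Qed.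
Let ee'1 : ival e + ival e' = 1.
Proof. by rewrite e'E subrKC. Qed.

(** Since e' R e = 0, the three other Peirce components multiply as the entries
    of a triangular matrix. *)
Definition peirce (x : R) : trimx (corner e e') :=
  TriMx (cut e e x) (cut e e' x) (cut e' e' x).

Fact peirce_zmod : zmod_morphism peirce.
Proof.
move=> x y; have cutB g h : cut g h (x - y) = cut g h x - cut g h y.
  apply/eqP; rewrite eq_sym subr_eq; apply/eqP/val_inj.
  by rewrite [RHS]cvalD /= -mulrDl -mulrDr subrK.
by rewrite /peirce !cutB.
Qed.

Fact peirce_monoid : monoid_morphism peirce.
Proof.
have split x y : x * y = x * ival e * y + x * ival e' * y.
  by rewrite -mulrDl -mulrDr ee'1 mulr1.
split.
  congr TriMx; apply: val_inj; rewrite /= mulr1 ?ee' ?ee ?e'e' //.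
  by rewrite mulr0 mul0r.
move=> x y; congr TriMx; apply: val_inj.
- rewrite [RHS]cval_mul /= (mulrA (ival e)) (split (ival e * x)) mulrDl.
  have -> : ival e * x * ival e' * y * ival e = 0.
    by rewrite -!(mulrA (ival e * x)) lower0 mulr0.
  by rewrite addr0 !mulrA -(mulrA _ (ival e) (ival e)) ee.
- rewrite [RHS]cvalD [X in X + _]cval_mul [X in _ + X]cval_mul /=.
  rewrite (mulrA (ival e)) (split (ival e * x)) mulrDl.
  rewrite !mulrA -(mulrA _ (ival e) (ival e)) ee.
  by rewrite -(mulrA _ (ival e') (ival e')) e'e'.
- rewrite [RHS]cval_mul /= (mulrA (ival e')) (split (ival e' * x)) mulrDl.
  rewrite lower0 !mul0r add0r !mulrA.
  by rewrite -(mulrA _ (ival e') (ival e')) e'e'.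
Qed.

HB.instance Definition _ := GRing.isZmodMorphism.Build R (trimx (corner e e'))
  peirce peirce_zmod.
HB.instance Definition _ := GRing.isMonoidMorphism.Build R
  (trimx (corner e e')) peirce peirce_monoid.

Lemma peirce_iso : ring_iso R (trimx (corner e e')).
Proof.
exists peirce; exists (fun u => cval (ulmx u) + cval (urmx u) + cval (drmx u)).
  move=> x /=; rewrite -mulrDr ee'1 mulr1.
  have <- : ival e' * x = ival e' * x * ival e'.
    by rewrite -[LHS]mulr1 -ee'1 mulrDr lower0 add0r.
  by rewrite -mulrDl ee'1 mul1r.
move=> [a x b]; rewrite /peirce /=; congr TriMx; apply: val_inj => /=;
  rewrite !mulrDr !mulrDl.
- rewrite cornerE -(corner_r x) -(corner_l b) !mulrA ee' -!mulrA e'e.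
  by rewrite !(mul0r, mulr0) !addr0.
- rewrite cornerE -(corner_r a) -(corner_l b) !mulrA ee' -!mulrA ee'.
  by rewrite !(mul0r, mulr0) addr0 add0r.
- rewrite cornerE -(corner_l a) -(corner_l x) !mulrA e'e.
  by rewrite !(mul0r, mulr0) !add0r.
Qed.

End Peirce.
End Corner.

(** If R is not abelian, some e R (1 - e) contains w <> 0; then e, e + w and
    any other element of e + e R (1 - e) or e + (1 - e) R e are idempotents
    over e. With no room for three of them, the Peirce decomposition of R is
    triangular with an off-diagonal part of order 2, and the formula for prime
    order leaves index 1 to the diagonal rings. *)
Lemma Nin2P (R : pzRingType) :
  (Nin_ge R 2 /\ ~ Nin_ge R 3) <->
  exists (S T : pzRingType) (W : bimodType S T),
    [/\ ring_iso R (trimx W), Nin S = 1%:E, Nin T = 1%:E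
      & ecard [set: W] = 2%:E].
Proof.
split=> [[R2 R3]|[S [T [W [iso /Nin1P S2 /Nin1P T2]]]]]; last first.
  rewrite -[2%:E]/(2%:R%:E) => /ecard_eqE[s [us s2 sW]].
  have sWP x : x \in s by exact/sW.
  have pr : prime (size s) by rewrite s2.
  rewrite !(ring_iso_Nin_ge _ iso) !(trimx_prime_Nin_ge us sWP _ pr) s2.
  split; first by exists 1%N, 1%N; split=> //; exact: Nin_ge1.
  move=> [i [j [Si Tj]]].
  by have := leq_mul (Nin_ge_bound S2 Si) (Nin_ge_bound T2 Tj); lia.
have [e [x [he w0]]] : exists e x : R, idempotents e /\ e * x * (1 - e) <> 0.
  apply: contrapT => h; apply: (@abelian_Nin R) R2 => e x he.
  by apply: contrapT => hx; apply: h; exists e, x.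
set w := e * x * (1 - e) in w0.
have over (y : R) : e * y + y * e = y -> y * y = 0 -> eta_set e (e + y).
  move=> ey yy; split.
    by rewrite /idempotents /= mulrDl !mulrDr he yy addr0 -addrA ey.
  by exists 2%N; rewrite opprD addrA subrr sub0r expr2 mulrNN.
have two (y : R) : e * y + y * e = y -> y * y = 0 -> y = 0 \/ y = w.
  move=> ey yy; have [->|y0] := pselect (y = 0); first by left.
  right; apply: contrapT => yw; apply: R3; exists e, [:: e; e + w; e + y].
  split=> [|//|z].
    rewrite /= !inE negb_or andbT; apply/andP; split; last first.
      by apply/eqP => /addrI /esym.
    by apply/andP; split; apply/eqP;
      rewrite -[LHS]addr0 => /addrI /esym.
  rewrite !inE => /or3P[] /eqP ->;
    [exact: eta_set_id | apply: over | exact: over].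
    by rewrite /w !mulrA he -[_ * (1 - e) * e]mulrA idemCM // mulr0 addr0.
  rewrite /w !mulrA -(mulrA _ (1 - e) e) idemCM //.
  by rewrite mulr0 !mul0r.
have upper (y : R) : e * y * (1 - e) = 0 \/ e * y * (1 - e) = w.
  apply: two.
    by rewrite !mulrA he -[_ * (1 - e) * e]mulrA idemCM // mulr0 addr0.
  rewrite !mulrA -(mulrA _ (1 - e) e) idemCM //.
  by rewrite mulr0 !mul0r.
have lower (y : R) : (1 - e) * y * e = 0.
  have [||//|yw] := two ((1 - e) * y * e).
  - by rewrite !mulrA idemMC // !mul0r add0r -[_ * e * e]mulrA he.
  - rewrite !mulrA -(mulrA _ e (1 - e)) idemMC //.
    by rewrite mulr0 !mul0r.
  case: w0; have := congr1 ( *%R e) yw.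
  by rewrite /w !mulrA idemMC // he !mul0r => <-.
pose ie := Idem he; pose ie' := Idem (idempotentsC he).
have lower0 (y : R) : ival ie' * y * ival ie = 0 by exact: lower.
have iso := peirce_iso (erefl : ival ie' = 1 - ival ie) lower0.
pose W : bimodType (corner ie ie) (corner ie' ie') := corner ie ie'.
pose sW : seq W := [:: cut ie ie' 0; cut ie ie' x].
have usW : uniq sW.
  rewrite /= inE andbT; apply/eqP => /(congr1 (@cval _ _ _)) /=.
  by rewrite mulr0 mul0r => /esym.
have sWP z : z \in sW.
  rewrite -(cutK z) !inE; case: (upper (cval z)) => h; apply/orP; [left|right];
    by apply/eqP/val_inj; rewrite /= h ?mulr0 ?mul0r.
have form n := trimx_prime_Nin_ge usW sWP n isT.
exists (corner ie ie), (corner ie' ie'), W; split=> //.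
- apply/Nin1P => S2; apply: R3; rewrite (ring_iso_Nin_ge _ iso) form.
  by exists 2%N, 1%N; split=> //; exact: Nin_ge1.
- apply/Nin1P => T2; apply: R3; rewrite (ring_iso_Nin_ge _ iso) form.
  by exists 1%N, 2%N; split=> //; exact: Nin_ge1.
- by rewrite (@ecard_list _ _ sW).
Qed.

(** * Abelian groups of order two and four *)

(** Translation by y permutes the finite closed set s, so that the sum of s
    absorbs (size s) y. *)
Lemma mulrn_size0 (V : zmodType) (s : seq V) (y : V) :
  uniq s -> (forall x, x \in s -> x + y \in s) -> y *+ size s = 0.
Proof.
move=> us sD; apply: (addrI (\sum_(x <- s) x)); rewrite addr0.
have -> : y *+ size s = \sum_(x <- s) y.
  by rewrite big_const_seq count_predT iter_addr_0.
rewrite -big_split /= -(big_map (fun x => x + y) predT id).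
have uY : uniq [seq x + y | x <- s] by rewrite map_inj_uniq //; exact: addIr.
have sub : {subset [seq x + y | x <- s] <= s} by move=> _ /mapP[x /sD xs ->].
apply: perm_big; apply: uniq_perm => //.
by have [] := uniq_min_size uY sub; rewrite ?size_map.
Qed.

Lemma group_iso_list (U V : zmodType) (r : seq U) (s : seq V)
    (f : {additive U -> V}) :
    uniq r -> (forall x, x \in r) -> uniq s -> (forall y, y \in s) ->
    size r = size s -> injective f ->
  group_iso V U.
Proof.
move=> ur rU us sV rs fI.
have ufr : uniq [seq f x | x <- r] by rewrite map_inj_uniq.
have frV y : y \in [seq f x | x <- r].
  have sub : {subset [seq f x | x <- r] <= s} by move=> z _; exact: sV.
  by have [|_ ->] := uniq_min_size ufr sub; rewrite ?sV // size_map rs.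
pose g y := nth 0 r (index y [seq f x | x <- r]).
have gK : cancel g f.
  move=> y; rewrite -(nth_map 0 0) ?nth_index //.
  by rewrite -(size_map f) index_mem.
have fK : cancel f g by move=> x; apply: fI; rewrite gK.
pose gA := GRing.isZmodMorphism.Build V U g (can2_zmod_morphism fK gK).
pose g' : {additive V -> U} := HB.pack g gA.
by exists g'; exists f.
Qed.

Lemma Zp_morphism (V : zmodType) (x : V) (n : nat) : x *+ n.+2 = 0 ->
  zmod_morphism (fun i : 'Z_n.+2 => x *+ i).
Proof.
move=> xn i j; have mulrn_mod k : x *+ (k %% n.+2) = x *+ k.
  by rewrite {2}(divn_eq k n.+2) mulrnDr mulnC mulrnA xn mul0rn add0r.
have ij : val (i - j) = ((i + (n.+2 - j) %% n.+2) %% n.+2)%N by [].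
rewrite ij mulrn_mod mulrnDr mulrn_mod mulrnBr ?xn ?sub0r //.
exact: ltnW (ltn_ord j).
Qed.

Lemma group_iso_Z2 (V : zmodType) (s : seq V) :
  uniq s -> (forall x, x \in s) -> size s = 2%N -> group_iso V 'Z_2.
Proof.
move=> us sV s2; have exp2 (x : V) : x *+ 2 = 0.
  by rewrite -s2; apply: mulrn_size0 => // y _; exact: sV.
have [x x0] : exists x : V, x != 0.
  apply: contrapT => h; have : (size s <= size [:: (0%R : V)])%N.
    apply: uniq_leq_size => // y _; rewrite inE.
    by apply/negPn/negP => y0; apply: h; exists y.
  by rewrite s2.
pose fA := GRing.isZmodMorphism.Build 'Z_2 V (fun i => x *+ i)
  (Zp_morphism (exp2 x)).
pose f : {additive 'Z_2 -> V} := HB.pack (fun i : 'Z_2 => x *+ i) fA.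
apply: (@group_iso_list _ _ (enum 'Z_2) s f) => //; first exact: enum_uniq.
- by move=> i; rewrite mem_enum.
- by rewrite s2 -cardE card_ord.
apply: raddf_inj => i /= i0; apply/val_inj; move: i0 (ltn_ord i) => /=.
by case: (val i) => [|[|//]] // /eqP; rewrite mulr1n (negPf x0).
Qed.

Lemma group_iso_Z4 (V : zmodType) (s : seq V) (x : V) :
    uniq s -> (forall x, x \in s) -> size s = 4%N -> x + x <> 0 ->
  group_iso V 'Z_4.
Proof.
move=> us sV s4 xx; have x4 : x *+ 4 = 0.
  by rewrite -s4; apply: mulrn_size0 => // y _; exact: sV.
pose fA := GRing.isZmodMorphism.Build 'Z_4 V (fun i => x *+ i) (Zp_morphism x4).
pose f : {additive 'Z_4 -> V} := HB.pack (fun i : 'Z_4 => x *+ i) fA.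
apply: (@group_iso_list _ _ (enum 'Z_4) s f) => //; first exact: enum_uniq.
- by move=> i; rewrite mem_enum.
- by rewrite s4 -cardE card_ord.
apply: raddf_inj => i /= i0; apply/val_inj; move: i0 (ltn_ord i) => /=.
have x1 : x <> 0 by move=> x0; apply: xx; rewrite x0 addr0.
case: (val i) => [|[|[|[|//]]]] // i0 _.
have {}i0 : x *+ 3 = 0 := i0.
by case: x1; have := x4; rewrite (mulrS x 3) i0 addr0.
Qed.

Lemma group_iso_klein (V : zmodType) (s : seq V) :
    uniq s -> (forall x, x \in s) -> size s = 4%N ->
    (forall x : V, x + x = 0) ->
  group_iso V ('Z_2 * 'Z_2)%type.
Proof.
move=> us sV s4 exp2.
have fresh (r : seq V) : (size r < 4)%N -> exists x, x \notin r.
  move=> r4; apply: contrapT => h.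
  suff : (size s <= size r)%N by rewrite leqNgt s4 r4.
  apply: uniq_leq_size => // y _.
  by apply/negPn/negP => y0; apply: h; exists y.
have [//|x] := fresh [:: 0]; rewrite inE => x0.
have [//|y] := fresh [:: 0; x]; rewrite !inE negb_or => /andP[y0 yx].
pose g (p : 'Z_2 * 'Z_2) : V := x *+ p.1 + y *+ p.2.
have gB : zmod_morphism g.
  move=> p q; rewrite /g opprD addrACA.
  by rewrite (@Zp_morphism _ x 0 (exp2 x)) (@Zp_morphism _ y 0 (exp2 y)).
pose f : {additive ('Z_2 * 'Z_2)%type -> V} :=
  HB.pack g (GRing.isZmodMorphism.Build _ _ g gB).
apply: (@group_iso_list _ _ (enum {: 'Z_2 * 'Z_2}) s f) => //.
- exact: enum_uniq.
- by move=> i; rewrite mem_enum.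
- by rewrite s4 -cardE card_prod !card_ord.
apply: raddf_inj => -[i j] /=; rewrite /g /= => ij.
suff [i0 j0] : i = 0%N :> nat /\ j = 0%N :> nat by congr (_, _); exact/val_inj.
move: ij (ltn_ord i) (ltn_ord j).
case: (nat_of_ord i) (nat_of_ord j) => [|[|//]] [|[|//]] //=.
- by move/eqP; rewrite add0r (negPf y0).
- by move/eqP; rewrite addr0 (negPf x0).
- move=> /eqP; rewrite addr_eq0 => /eqP xy; case/eqP: yx.
  by apply/eqP; rewrite [x in _ == x](xy : x = - y) -addr_eq0 exp2.
Qed.

Lemma group_iso_listing (U V : zmodType) (r : seq U) :
    group_iso V U -> uniq r -> (forall x, x \in r) ->
  exists s : seq V, [/\ uniq s, forall x, x \in s & size s = size r].
Proof.
move=> [f [g fK gK]] ur rU; exists (map g r).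
rewrite map_inj_uniq ?size_map //; last exact: can_inj gK.
by split=> // x; rewrite -(fK x) map_f.
Qed.

(** * Bimodules of order four *)

Section OrderFour.
Variables (A B : pzRingType) (M : bimodType A B) (sM : seq M).
Hypotheses (usM : uniq sM) (sMP : forall x, x \in sM).

Lemma Nin_trimx_ge_size : Nin_ge (trimx M) (size sM).
Proof.
apply/(trimx_Nin_ge usM sMP); exists 1, 0, [:: 1], [:: 0]; split.
- by split=> // e; rewrite inE => /eqP ->; exact/eta_set_id/idempotents1.
- by split=> // e; rewrite inE => /eqP ->; exact/eta_set_id/idempotents0.
- by rewrite /total_weight !big_cons !big_nil !addn0 weight10.
Qed.

(** M is then the direct sum of two subgroups of order 2. *)
Lemma weight2_exponent (e : A) (f : B) : size sM = 4%N ->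
    idempotents e -> idempotents f -> weight sM e f = 2%N ->
  forall x : M, x + x = 0.
Proof.
move=> s4 he hf h1.
have h2 : weight sM (1 - e) f = 2%N.
  by have := weightCl usM sMP he hf; rewrite s4 h1; lia.
have exp2 e' : idempotents e' -> weight sM e' f = 2%N ->
    forall x : M, offproj e' f x *+ 2 = 0.
  rewrite /weight -size_filter => he' <- x.
  apply: (@mulrn_size0 M) => [|y]; first by rewrite filter_uniq.
  rewrite !mem_filter !sMP !andbT => /eqP hy.
  by rewrite offprojD hy offproj_idem.
move=> x; have := exp2 _ (idempotentsC he) h2 x.
rewrite offprojCl mulrnBl (exp2 _ he h1) subr0; exact.
Qed.

(** This nonvanishing condition and the next one occur when B, respectively
    A, has index 2. *)
Definition offdiag_condition_r := forall (e : A) (b f : B), idempotents e ->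
  ecard (eta_set b) = 2%:E -> eta_set b f -> offdiag M e f <> [set 0].

Definition offdiag_condition_l := forall (a e : A) (f : B), idempotents f ->
  ecard (eta_set a) = 2%:E -> eta_set a e -> offdiag M e f <> [set 0].

Lemma trimx_Nin4P : size sM = 4%N ->
  Nin (trimx M) = 4%:E <->
  [\/ Nin A = 1%:E /\ Nin B = 1%:E,
      [/\ Nin A = 1%:E, Nin_ge B 2 /\ ~ Nin_ge B 3 & offdiag_condition_r]
    | [/\ Nin B = 1%:E, Nin_ge A 2 /\ ~ Nin_ge A 3 & offdiag_condition_l]].
Proof.
move=> s4; have ecard2 (R : pzRingType) (a : R) : ~ Nin_ge R 3 ->
    ecard (eta_set a) = 2%:E <-> at_least 2 (eta_set a).
  move=> R3; rewrite -[2%:E]/(2%:R%:E) ecard_eqP; split=> [[]//|h].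
  by split=> // h3; apply: R3; exists a.
have -> : Nin (trimx M) = 4%:E <-> ~ weight_ge (weight sM) 5.
  rewrite Nin4_geP (trimx_Nin_ge usM sMP 5).
  by split=> [[]//|h]; split=> //; rewrite -s4; exact: Nin_trimx_ge_size.
rewrite weight4P; last 2 first.
- by move=> e f he hf; rewrite weightCl.
- by move=> e f he hf; rewrite weightCr.
rewrite (propext (Nin1P A)) (propext (Nin1P B)).
split=> -[?|[h1 [h2 h3] cond]|[h1 [h2 h3] cond]].
- exact: Or31.
- apply: Or32; split=> // e b f he /(ecard2 _ _ h3) hb bf.
  by rewrite -(weight1P usM sMP) //; [exact: cond hb bf | case: bf].
- apply: Or33; split=> // a e f hf /(ecard2 _ _ h3) ha ae.
  by rewrite -(weight1P usM sMP) //; [exact: cond ha ae | case: ae].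
- exact: Or31.
- apply: Or32; split=> // e b f he /(ecard2 _ _ h3) hb bf.
  by rewrite (weight1P usM sMP) //; [exact: cond hb bf | case: bf].
- apply: Or33; split=> // a e f hf /(ecard2 _ _ h3) ha ae.
  by rewrite (weight1P usM sMP) //; [exact: cond ha ae | case: ae].
Qed.

(** For a decomposition f of b, the condition at e = 1 and at e = 0 says that
    both weights of product 4 differ from 1. *)
Lemma offdiag_condition_r_exponent : size sM = 4%N -> Nin_ge B 2 ->
  ~ Nin_ge B 3 -> offdiag_condition_r -> forall x : M, x + x = 0.
Proof.
move=> s4 [b hb] B3 cond; have /at_least2P[f [_ [_ bf _]]] := hb.
have [hf _] := bf; have eb : ecard (eta_set b) = 2%:E.
  rewrite -[2%:E]/(2%:R%:E); apply/ecard_eqP; split=> // h3.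
  by apply: B3; exists b.
have n1 e : idempotents e -> weight sM e f <> 1%N.
  by move=> he; rewrite (weight1P usM sMP) //; exact: cond eb bf.
have h1 := n1 _ (idempotents1 A).
have h0 := n1 _ (idempotentsC (idempotents1 A)).
have := weightCl usM sMP (idempotents1 A) hf; rewrite s4.
move=> /factor4[] [w1 w0] //; exact: (weight2_exponent s4 (idempotents1 A) hf).
Qed.

Lemma offdiag_condition_l_exponent : size sM = 4%N -> Nin_ge A 2 ->
  ~ Nin_ge A 3 -> offdiag_condition_l -> forall x : M, x + x = 0.
Proof.
move=> s4 [a ha] A3 cond; have /at_least2P[e [_ [_ ae _]]] := ha.
have [he _] := ae; have ea : ecard (eta_set a) = 2%:E.
  rewrite -[2%:E]/(2%:R%:E); apply/ecard_eqP; split=> // h3.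
  by apply: A3; exists a.
have n1 f : idempotents f -> weight sM e f <> 1%N.
  by move=> hf; rewrite (weight1P usM sMP) //; exact: cond ea ae.
have h1 := n1 _ (idempotents1 B).
have h0 := n1 _ (idempotentsC (idempotents1 B)).
have := weightCr usM sMP he (idempotents1 B); rewrite s4.
move=> /factor4[] [w1 w0] //; exact: (weight2_exponent s4 he (idempotents1 B)).
Qed.

End OrderFour.

(** * The rings of nil clean index four *)

Theorem theorem2p1 (A B : pzRingType) (M : bimodType A B)
    (hM : exists x : M, x <> 0) :
  Nin (trimx M) = 4%:E <->
  [\/ group_iso M 'Z_2 /\ (Nin A * Nin B = 2%:E)%E,
      group_iso M 'Z_4 /\ (Nin A = 1%:E /\ Nin B = 1%:E)
    | group_iso M ('Z_2 * 'Z_2)%type /\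
      [\/ Nin A = 1%:E /\ Nin B = 1%:E,
          [/\ Nin A = 1%:E,
              exists (S T : pzRingType) (W : bimodType S T),
                [/\ ring_iso B (trimx W), Nin S = 1%:E, Nin T = 1%:E
                  & ecard [set: W] = 2%:E]
            & forall (e : A) (b f : B), idempotents e ->
                ecard (eta_set b) = 2%:E -> eta_set b f ->
                offdiag M e f <> [set 0]]
        | [/\ Nin B = 1%:E,
              exists (S T : pzRingType) (W : bimodType S T),
                [/\ ring_iso A (trimx W), Nin S = 1%:E, Nin T = 1%:E
                  & ecard [set: W] = 2%:E]
            & forall (a e : A) (f : B), idempotents f ->
                ecard (eta_set a) = 2%:E -> eta_set a e ->
                offdiag M e f <> [set 0]]]].
Proof.
split=> [N4|].
  have [sM [usM sM4 sMP']] : exists s : seq M,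
      [/\ uniq s, (size s <= 4)%N & forall x, [set: M] x <-> x \in s].
    apply: bounded_list => M5.
    move: N4 => /Nin4_geP[_]; apply; exists (TriMx 1 0 0 : trimx M).
    pose g x : trimx M := TriMx 1 x 0.
    apply: (@at_least_image _ _ _ _ _ g _ _ M5) => [x y [] //|x _].
    apply/trimx_eta; split; [| |exact: offproj10].
      exact/eta_set_id/idempotents1.
    exact/eta_set_id/idempotents0.
  have sMP x : x \in sM by exact/sMP'.
  have sM2 : (2 <= size sM)%N.
    have [x x0] := hM; apply: (@uniq_leq_size _ [:: x; 0]) => [|y _] //=.
    by rewrite inE andbT; apply/eqP.
  have [s4|s4] := eqVneq (size sM) 4%N.
    have D := proj1 (trimx_Nin4P usM sMP s4) N4.
    have [exp2|/existsNP[x xx]] := pselect (forall x : M, x + x = 0).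
      apply: Or33; split; first exact: group_iso_klein usM sMP s4 exp2.
      case: D => [?|[h1 /Nin2P h2 h3]|[h1 /Nin2P h2 h3]];
        by [exact: Or31 | exact: Or32 | exact: Or33].
    apply: Or32; split; first exact: group_iso_Z4 usM sMP s4 xx.
    case: D => // -[_ [h2 h3] h]; case: xx.
      exact: (offdiag_condition_r_exponent usM sMP s4 h2 h3 h).
    exact: (offdiag_condition_l_exponent usM sMP s4 h2 h3 h).
  have [s2|s2] := eqVneq (size sM) 2%N.
    apply: Or31; split; first exact: group_iso_Z2 usM sMP s2.
    exact/(trimx_order2_Nin4P usM sMP s2).
  have s3 : size sM = 3%N by move: (size sM) sM2 sM4 s2 s4 => k; lia.
  by case: (trimx_order3_Nin usM sMP s3).
move=> [[iso N2]|[iso N1]|[iso D]].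
- have [|sM [usM sMP sM2]] := group_iso_listing iso (enum_uniq 'Z_2).
    by move=> i; rewrite mem_enum.
  have s2 : size sM = 2%N by rewrite sM2 -cardE card_ord.
  exact/(trimx_order2_Nin4P usM sMP s2).
- have [|sM [usM sMP sM4]] := group_iso_listing iso (enum_uniq 'Z_4).
    by move=> i; rewrite mem_enum.
  have s4 : size sM = 4%N by rewrite sM4 -cardE card_ord.
  by apply/(trimx_Nin4P usM sMP s4); exact: Or31.
- have [|sM [usM sMP sM4]] := group_iso_listing iso (enum_uniq {: 'Z_2 * 'Z_2}).
    by move=> i; rewrite mem_enum.
  have s4 : size sM = 4%N by rewrite sM4 -cardE card_prod !card_ord.
  apply/(trimx_Nin4P usM sMP s4).
  case: D => [?|[h1 /Nin2P h2 h3]|[h1 /Nin2P h2 h3]];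
    by [exact: Or31 | exact: Or32 | exact: Or33].
Qed.
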